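(* There exists a deterministic online algorithm for Online Bin Stretching with $m=3$ bins that achieves stretching factor $1+3/8 = 11/8 = 1.375$. That is, for every input sequence of items with sizes in $[0,1]$ which (as a whole) can be packed offline into $3$ bins of capacity $1$, the algorithm packs every item immediately and irrevocably upon arrival into one of $3$ bins so that the total size in each bin never exceeds $11/8$.
   Context: Online Bin Stretching: an integer $m$ is given, and then a sequence of items $i_1,i_2,\dots$ with sizes $s(i)\in[0,1]$ arrives online, one by one; each item must be packed immediately and irrevocably into one of $m$ bins before the next item is seen. It is guaranteed that the whole sequence can be packed into $m$ bins of capacity $1$ (the algorithm knows $m$ but not the future items nor the length of the sequence). An algorithm has stretching factor $R\ge 1$ if for every such sequence it produces a packing into the $m$ bins in which every bin has total size at most $R$. *)

(* Defs.v *)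
From mathcomp Require Import all_boot all_order all_algebra.
From mathcomp Require Import reals.

Set Implicit Arguments.
Unset Strict Implicit.
Unset Printing Implicit Defensive.

Import Order.TTheory GRing.Theory Num.Theory.

Local Open Scope ring_scope.

(* An input is a finite sequence of item sizes in order of arrival. *)
Definition item_sizes (R : realType) (s : seq R) : Prop :=
  {in s, forall x, 0 <= x <= 1}.

Definition packing (R : realType) (m : nat) (s : seq R) : Type :=
  'I_(size s) -> 'I_m.

Definition bin_load (R : realType) (m : nat) (s : seq R)
    (p : packing m s) (b : 'I_m) : R :=
  \sum_(i < size s | p i == b) s`_i.

Definition fits (R : realType) (m : nat) (s : seq R) (p : packing m s)
    (c : R) : Prop :=
  forall b : 'I_m, bin_load p b <= c.

(* [alg past x] is the bin receiving the item of size [x] that arrives after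
   the items [past].  Since the algorithm is deterministic, [past] determines
   its earlier decisions, so they are not passed as an argument. *)
Definition online_algorithm (R : realType) (m : nat) : Type :=
  seq R -> R -> 'I_m.

Definition online_packing (R : realType) (m : nat)
    (alg : online_algorithm R m) (s : seq R) : packing m s :=
  fun i => alg (take i s) s`_i.

Arguments online_packing {R m} alg s.

Definition has_stretching_factor (R : realType) (m : nat)
    (alg : online_algorithm R m) (rho : R) : Prop :=
  1 <= rho /\
  forall s : seq R,
    item_sizes s ->
    (exists p : packing m s, fits p 1) ->
    fits (online_packing alg s) rho.

(* Main.v *)
Require Import Defs.
From mathcomp Require Import all_boot all_order all_algebra.
From mathcomp Require Import reals boolp.
From mathcomp Require Import lra.

Import Order.TTheory GRing.Theory Num.Theory.

Local Open Scope ring_scope.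

(** Scale the sizes by 16, so that the offline bins have capacity 16 and the
    online ones capacity 22.  A configuration with loads [a], [b], [c] is won
    when two bins have total load 26 (everything else fits into the third, as
    the volume is at most 48), when one bin has load between 4 and 6 (fill a
    second bin until an item overflows it; that item fits into the first bin
    and brings the pair above 26), and in a few derived situations.  The
    algorithm moves from one such situation to the next.  The situations where
    a bin must be given up to a large item rely on the offline guarantee: too
    many large items, together with the items already seen, do not fit into
    three bins of capacity 16. *)

(** * Offline packings of the scaled items *)

Section Packable.

Context {R : realFieldType}.
Implicit Types (s t : seq R) (a b c h u v w x y z : R).

(** The arguments [u], [v], [w] are residual capacities. Placing items one at a time turns the
    exclusion of a packing into case analysis and linear arithmetic. *)
Fixpoint packs s u v w : Prop :=
  if s is x :: s' then
    0 <= x /\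
    [\/ packs s' (u - x) v w, packs s' u (v - x) w | packs s' u v (w - x)]
  else [/\ 0 <= u, 0 <= v & 0 <= w].

Local Notation packable s := (packs s 16 16 16).

Lemma packs_cons {x s u v w} : packs (x :: s) u v w -> 0 <= x /\
  [\/ packs s (u - x) v w, packs s u (v - x) w | packs s u v (w - x)].
Proof. by []. Qed.

Lemma packs_capacity {s u v w} : packs s u v w -> [/\ 0 <= u, 0 <= v & 0 <= w].
Proof.
elim: s u v w => [//|x s IHs] u v w [x0].
by case=> /IHs [? ? ?]; split=> //; lra.
Qed.

Lemma packs_sum {s u v w} : packs s u v w -> \sum_(x <- s) x <= u + v + w.
Proof.
elim: s u v w => [|x s IHs] u v w; first by rewrite big_nil => -[? ? ?]; lra.
by rewrite big_cons => -[_]; case=> /IHs ?; lra.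
Qed.

Lemma packs_widen {s u v w} u' v' w' :
  packs s u v w -> u <= u' -> v <= v' -> w <= w' -> packs s u' v' w'.
Proof.
elim: s u v w u' v' w' => [|x s IHs] u v w u' v' w' /=.
  by move=> [? ? ?] *; split; lra.
move=> [x0 H] uu vv ww; split=> //.
case: H => /IHs H; [apply: Or31|apply: Or32|apply: Or33]; apply: H; lra.
Qed.

Lemma packs_subseq {s t u v w} : subseq t s -> packs s u v w -> packs t u v w.
Proof.
elim: s t u v w => [|x s IHs] [|y t] u v w //.
- by move=> _ /packs_capacity.
- rewrite /=; case: eqP => [-> sub|_ sub] [x0 H]; last first.
    case: H => /(IHs _ _ _ _ sub) H; apply: packs_widen H _ _ _; lra.
  by split=> //; case: H => /(IHs _ _ _ _ sub) H;
    [apply: Or31|apply: Or32|apply: Or33].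
Qed.

Lemma packsC12 {s u v w} : packs s u v w -> packs s v u w.
Proof.
elim: s u v w => [|x s IHs] u v w /=; first by case.
by case=> x0 [] /IHs H; split=> //; [apply: Or32|apply: Or31|apply: Or33].
Qed.

Lemma packsC23 {s u v w} : packs s u v w -> packs s u w v.
Proof.
elim: s u v w => [|x s IHs] u v w /=; first by case.
by case=> x0 [] /IHs H; split=> //; [apply: Or31|apply: Or33|apply: Or32].
Qed.

Lemma packable_item {x s} : packable (x :: s) -> 0 <= x <= 16.
Proof. by case/packs_cons=> x0 [] /packs_capacity [? ? ?]; lra. Qed.

(** No two of the three items share a bin, and the bins are interchangeable. *)
Lemma packable_3big {s x y z} : 16 < x + y -> 16 < x + z -> 16 < y + z ->
  packable [:: z, y, x & s] -> packs s (16 - z) (16 - y) (16 - x).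
Proof.
move=> xy xz yz zyxs; have [_ K] := packs_cons zyxs.
have {}K : packs [:: y, x & s] (16 - z) 16 16.
  by case: K => K; [exact: K|exact: packsC12|exact/packsC12/packsC23].
have {}K : packs (x :: s) (16 - z) (16 - y) 16.
  case: (packs_cons K) => y0 {}K; case: K => [K|//|K]; last exact: packsC23.
  by case: (packs_capacity K) => ? ? ?; lra.
by case: (packs_cons K) => x0 {}K; case: K => // K; case: (packs_capacity K) => ? ? ?; lra.
Qed.

Lemma four_big {x y z x'} : 16 < x + y -> 16 < x + z -> 16 < y + z ->
  16 < x' + x -> 16 < x' + y -> 16 < x' + z -> ~ packable [:: z; y; x; x'].
Proof.
move=> xy xz yz x'x x'y x'z /packable_3big H.
by case: (packs_cons (H xy xz yz)) => ? []; case=> ? ? ?; lra.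
Qed.

Ltac place H := let t0 := fresh in case: (packs_cons H) => t0 {}H; case: H => H;
  try by case: (packs_capacity H) => ? ? ?; lra.

(** The three items above [h] occupy distinct bins, leaving less than [16 - h] in each; so no bin
    takes two of the other four items. *)
Lemma four_pairs_3big {x y z x1 x2 x3 x4 h} : 8 <= h ->
  h < x -> h < y -> h < z ->
  16 <= x1 + x2 + h -> 16 <= x1 + x3 + h -> 16 <= x1 + x4 + h ->
  16 <= x2 + x3 + h -> 16 <= x2 + x4 + h -> 16 <= x3 + x4 + h ->
  ~ packable [:: z; y; x; x1; x2; x3; x4].
Proof.
move=> h8 hx hy hz x12 x13 x14 x23 x24 x34 /packable_3big H.
have {H} : packs [:: x1; x2; x3; x4] (16 - z) (16 - y) (16 - x).
  by apply: H; lra.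
by move=> H; place H; place H; place H; place H.
Qed.

(** * Configurations and the coinductive notion of winning *)

(* In a configuration, [s] lists the items seen so far, the latest one first. *)
Definition valid s a b c :=
  [/\ 0 <= a, 0 <= b, 0 <= c & \sum_(y <- s) y = a + b + c].

Definition move (W : seq R -> R -> R -> R -> Prop) s a b c x :=
  [\/ a + x <= 22 /\ W (x :: s) (a + x) b c,
      b + x <= 22 /\ W (x :: s) a (b + x) c |
      c + x <= 22 /\ W (x :: s) a b (c + x)].

Definition stable W := forall s a b c x,
  W s a b c -> valid s a b c -> packable (x :: s) -> move W s a b c x.

(* The greatest stable set of configurations, so that winning is coinductive. *)
Definition win s a b c := exists2 W, stable W & W s a b c.

Lemma win_stable : stable win.
Proof.
move=> s a b c x [W Wst Wabc] vs px.
by case: (Wst _ _ _ _ _ Wabc vs px) => -[ax Wx];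
  [apply: Or31|apply: Or32|apply: Or33]; split=> //; exists W.
Qed.

Lemma win12 {s a b c} : win s b a c -> win s a b c.
Proof.
case=> W Wst Wabc; exists (fun s a b c => W s b a c) => // {Wabc}s {}a {}b {}c x.
move=> Wabc [a0 b0 c0 sabc] px.
have vs : valid s b a c by split=> //; lra.
case: (Wst _ _ _ _ _ Wabc vs px) => -[].
- by move=> *; apply: Or32.
- by move=> *; apply: Or31.
- by move=> *; apply: Or33.
Qed.

Lemma win23 {s a b c} : win s a c b -> win s a b c.
Proof.
case=> W Wst Wabc; exists (fun s a b c => W s a c b) => // {Wabc}s {}a {}b {}c x.
move=> Wabc [a0 b0 c0 sabc] px.
have vs : valid s a c b by split=> //; lra.
case: (Wst _ _ _ _ _ Wabc vs px) => -[].
- by move=> *; apply: Or31.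
- by move=> *; apply: Or33.
- by move=> *; apply: Or32.
Qed.

Variant reply (W : seq R -> R -> R -> R -> Prop) s a b c x : Prop :=
| Won of win s a b c
| StayA of a + x <= 22 & W (x :: s) (a + x) b c
| StayB of b + x <= 22 & W (x :: s) a (b + x) c
| StayC of c + x <= 22 & W (x :: s) a b (c + x)
| WinA of a + x <= 22 & win (x :: s) (a + x) b c
| WinB of b + x <= 22 & win (x :: s) a (b + x) c
| WinC of c + x <= 22 & win (x :: s) a b (c + x).

(** Coinduction up to [win]: a reply may preserve the invariant [W] or leave it for a configuration
    already known to be won. *)
Lemma win_coind {W s a b c} :
    (forall s a b c x, W s a b c -> packable (x :: s) ->
       0 <= a -> 0 <= b -> 0 <= c -> \sum_(y <- s) y = a + b + c ->
       a + b + c + x <= 48 -> 0 <= x <= 16 -> reply W s a b c x) ->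
  W s a b c -> win s a b c.
Proof.
move=> H Wabc; exists (fun s a b c => W s a b c \/ win s a b c); last by left.
move=> {Wabc}s {}a {}b {}c x Wwin vs px.
have upto : win s a b c ->
    move (fun s a b c => W s a b c \/ win s a b c) s a b c x.
  move=> /win_stable/(_ vs px) [] [? ?];
  by [apply: Or31; split; [|right]|apply: Or32; split; [|right]|
      apply: Or33; split; [|right]].
case: Wwin => [Wabc|]; last exact: upto.
have [a0 b0 c0 sabc] := vs.
have vol : a + b + c + x <= 48.
  by have := packs_sum px; rewrite big_cons sabc; lra.
case: (H _ _ _ _ _ Wabc px a0 b0 c0 sabc vol (packable_item px)) => [/upto//| | | | | | ];
  move=> ax Wx;
  by [apply: Or31; split; [|left]|apply: Or32; split; [|left]|
      apply: Or33; split; [|left]|apply: Or31; split; [|right]|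
      apply: Or32; split; [|right]|apply: Or33; split; [|right]].
Qed.

(** * Configurations won by volume alone *)

Lemma win_two_full {s a b c} : 26 <= a + b -> win s a b c.
Proof.
apply: (@win_coind (fun s a b c => 26 <= a + b)).
by move=> {}s {}a {}b {}c x *; apply: StayC => //; lra.
Qed.

Lemma win_4_6 {s a b c} : 4 <= a <= 6 -> win s a b c.
Proof.
apply: (@win_coind (fun s a b c => 4 <= a <= 6)).
move=> {}s {}a {}b {}c x *.
case: (lerP (b + x) 22) => ?; first by apply: StayB.
by apply: WinA; [|apply: win_two_full]; lra.
Qed.

(** Bin [c] is filled until some [x] overflows it; [x] goes to [b]. If [b + x] reaches 11, then [a]
    and [b] total 26; otherwise [x < 11], so [c > 11] and [a] and [c] do. *)
Lemma win_15 {s a b c} : 15 <= a -> b <= 6 -> win s a b c.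
Proof.
move=> a15 b6; apply: (@win_coind (fun s a b c => 15 <= a /\ b <= 6)) => //.
move=> {a15 b6}s {}a {}b {}c x [? ?] *.
case: (lerP (c + x) 22) => ?; first by apply: StayC.
apply: WinB; first lra.
by case: (lerP 11 (b + x)) => ?; [|apply: win23]; apply: win_two_full; lra.
Qed.

(** An item overflowing [a] brings the pair above 26 on [b], as [b] is at least 4. If it overflows
    [b] too, then [a + c + x >= b + 4 + x > 26]. *)
Lemma win_balanced {s a b c} :
  4 <= b -> c <= 6 -> b + 4 <= a + c -> win s a b c.
Proof.
move=> b4 c6 bac.
apply: (@win_coind (fun s a b c => [/\ 4 <= b, c <= 6 & b + 4 <= a + c])) => //.
move=> {b4 c6 bac}s {}a {}b {}c x [? ? ?] *.
case: (lerP (a + x) 22) => ?; first by apply: StayA => //; split; lra.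
case: (lerP (b + x) 22) => ?; first by apply: WinB; [|apply: win_two_full]; lra.
by apply: WinC; [|apply: win23; apply: win_two_full]; lra.
Qed.

(** If an item overflowing [a] cannot lift [a + b] to 26, then [x < 26 - (a + b)]. On [c] it then
    gives [c + x + 4 <= a + b], which is where [15 + c / 2] comes from, and [win_balanced]
    applies. *)
Lemma win_two_15 {s a b c} :
  15 + c / 2 <= a + b -> b <= 6 -> c <= 6 -> win s a b c.
Proof.
move=> abc b6 c6.
apply: (@win_coind (fun s a b c => [/\ 15 + c / 2 <= a + b, b <= 6 & c <= 6])) => //.
move=> {abc b6 c6}s {}a {}b {}c x [? ? ?] *.
case: (lerP 15 a) => ?; first by apply: Won; exact: win_15.
case: (lerP (a + x) 22) => ?; first by apply: StayA => //; split; lra.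
case: (lerP 26 (a + b + x)) => ?.
  by apply: WinB; [|apply: win_two_full]; lra.
by apply: WinC; [|apply/win23/win_balanced]; lra.
Qed.

(** * Bounding the number of items that can overflow a bin *)

Definition no_three_over s a :=
  forall x y z, 22 < a + x -> 22 < a + y -> 22 < a + z ->
  ~ packable [:: z, y, x & s].

Lemma no_three_over_subseq {t s a} :
  subseq t s -> no_three_over t a -> no_three_over s a.
Proof.
move=> ts H x y z ? ? ? p; apply: (H x y z) => //; apply: packs_subseq p.
by rewrite /= !eqxx.
Qed.

Lemma no_three_over_cons {x s a} : no_three_over s a -> no_three_over (x :: s) a.
Proof. exact: no_three_over_subseq (subseq_cons s x). Qed.

(** Three such items exceed [66 - 3 * a] in volume, which pushes the total above 48. *)
Lemma no_three_over_volume {s a b c} : \sum_(y <- s) y = a + b + c ->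
  2 * a <= 18 + b + c -> no_three_over s a.
Proof.
by move=> sabc abc x y z ? ? ? /packs_sum; rewrite !big_cons sabc; lra.
Qed.

(** With [x] on [b], the first two bins lack less than [d = 4 - b <= 2] to 26, so any item of size
    at least [d] that fits into [a] wins. Smaller items go to [c], which cannot jump over the range
    from 4 to 6. At most one more item overflows [a]; it goes to [c] and leads to [one]. *)
Lemma win_no_three_over {s a b c x} :
    6 <= a -> 2 <= b <= 6 -> c < 4 -> 22 < a + x -> 0 <= x <= 16 ->
    no_three_over s a ->
  win (x :: s) a (b + x) c.
Proof.
move=> a6 b26 c4 ax x16 no3.
have no2 y z : 22 < a + y -> 22 < a + z -> ~ packable [:: z, y, x & s].
  by move=> *; exact: no3.
pose d : R := 4 - b.
pose one s (a b c : R) := [/\ 6 <= a, 26 - d <= a + b &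
  forall y, 22 < a + y -> ~ packable (y :: s)].
pose two s (a b c : R) := [/\ 6 <= a, 26 - d <= a + b, c < 4 &
  forall y z, 22 < a + y -> 22 < a + z -> ~ packable [:: z, y & s]].
have d2 : d <= 2 by rewrite /d; lra.
have abd : two (x :: s) a (b + x) c by split=> //; rewrite /d; lra.
move: d d2 @one @two abd => d d2 one two {a6 b26 c4 ax x16 no3 no2}.
have one_win s' a' b' c' : one s' a' b' c' -> win s' a' b' c'.
  apply: (@win_coind one) => {}s {}a {}b {}c {}x [a6 abd no1] px *.
  case: (lerP 26 (a + b)) => ab; first by apply: Won; exact: win_two_full.
  (* Bin [c] may be nearly full now, so small items go to [b], which is below 20 because [a] is at
     least 6. *)
  case: (ltrP x d) => xd.
    apply: StayB; first lra; split=> //; first lra.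
    move=> y ay p; apply: (no1 y) => //; apply: packs_subseq p.
    by rewrite /= !eqxx; exact: subseq_cons.
  case: (lerP (a + x) 22) => ax; last by case: (no1 x).
  by apply: WinA => //; apply: win_two_full; lra.
apply: (@win_coind two) => {}s {}a {}b {}c {}x [a6 abd c4 no2] px *.
case: (ltrP x d) => xd.
  case: (ltrP (c + x) 4) => cx; last first.
    by apply: WinC; [|apply/win23/win12/win_4_6]; lra.
  apply: StayC; first lra; split=> // y z ay az p.
  apply: (no2 y z) => //; apply: packs_subseq p.
  by rewrite /= !eqxx; exact: subseq_cons.
case: (lerP (a + x) 22) => ax.
  by apply: WinA => //; apply: win_two_full; lra.
by apply: WinC; [lra|apply: one_win; split=> // y ?; exact: no2].
Qed.


(** * Configurations reached after the first medium or large items *)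

(** While [a + b < 15], the bound [3 <= b] gives [a < 12]. An item overflowing [a] then exceeds 10
    and shares no offline bin with [a0] or with another such item. *)
Lemma win_big_3_6 {s a b a0} :
  a0 \in s -> 6 < a0 -> a0 <= a -> 3 <= b <= 6 -> win s a b 0.
Proof.
move=> sa0 a06 a0a b36.
apply: (@win_coind (fun s a b c =>
  [/\ a0 \in s, a0 <= a, 3 <= b <= 6 & c = 0])) => //.
move=> {sa0 a0a b36}s' {}a {}b c x [sa0 a0a b36 ->] *.
case: (lerP 15 (a + b)) => ?; first by apply: Won; apply: win_two_15; lra.
case: (lerP (a + x) 22) => ?.
  by apply: StayA => //; split=> //; [rewrite inE sa0 orbT|lra].
apply: WinB; first lra.
apply: win_no_three_over => //; try lra.
apply: (@no_three_over_subseq [:: a0]); first by rewrite sub1seq.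
by move=> m n p ? ? ?; apply: four_big; lra.
Qed.

Lemma win_two_small {s a b c} : 6 <= a -> 2 <= b < 4 -> 2 <= c < 4 ->
  19 / 2 + 3 / 4 * b <= a + c -> no_three_over s a -> win s a b c.
Proof.
move=> a6 b24 c24 bac no3.
apply: (@win_coind (fun s a b c => [/\ 6 <= a, 2 <= b < 4, 2 <= c < 4,
  19 / 2 + 3 / 4 * b <= a + c & no_three_over s a])) => //.
move=> {a6 b24 c24 bac no3}{}s {}a {}b {}c x [a6 b24 c24 bac no3] *.
case: (ltrP (c + x) 4) => ?.
  by apply: StayC; [lra|split=> //; try lra; exact: no_three_over_cons].
case: (lerP (c + x) 6) => ?.
  by apply: WinC; [lra|apply/win23/win12/win_4_6; lra].
case: (lerP (a + x) 22) => ?; last first.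
  by apply: WinC; [lra|apply/win23/win_no_three_over => //; lra].
(* If this fails, [x < 15 + b / 2 - (a + c)], and the bound [19 / 2 + 3 / 4 * b] is what makes
   [b + x + 4 <= a + c]. *)
case: (lerP (15 + b / 2) (a + x + c)) => ?.
  by apply: WinA; [lra|apply/win23/win_two_15; lra].
by apply: WinB; [lra|apply: win_balanced; lra].
Qed.

Lemma win_12_3_4 {s a b} : 12 <= a + b -> 3 <= b < 4 -> 6 <= a ->
  2 * a <= 18 + b -> win s a b 0.
Proof.
move=> ab b34 a6 ab18.
apply: (@win_coind (fun s a b c => [/\ 12 <= a + b, 3 <= b < 4, 6 <= a,
  2 * a <= 18 + b & c = 0])) => //.
move=> {ab b34 a6 ab18}{}s {}a {}b c x [ab b34 a6 ab18 ->] px _ _ _ sabc *.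
have no3 : no_three_over s a by apply: no_three_over_volume sabc _; lra.
case: (lerP (a + x) 22) => ?; last first.
  by apply: WinB; [lra|apply: win_no_three_over => //; lra].
case: (lerP 15 (a + x + b)) => ?; first by apply: WinA; [|apply: win_two_15]; lra.
case: (ltrP (b + x) 4) => ?; first by apply: StayB; [lra|split; lra].
case: (lerP (b + x) 6) => ?; first by apply: WinB; [lra|apply/win12/win_4_6; lra].
(* Here [2 < x < 3], and [19 / 2 + 3 / 4 * 3 < 12]. *)
apply: WinC; first lra.
by apply/win23/win_two_small; try lra; exact: no_three_over_cons.
Qed.

(** Bin [a] is filled; an item overflowing it wins on [c] if it fits there. The first that does not
    goes to [b], and by hypothesis a second one fits into [b] again. Such items exceed [c - 4],
    because [a + c < 26]. *)
Lemma win_two_over {s a b c} : 4 <= c -> b <= 6 ->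
    (forall m n, 22 < c + m -> 22 < c + n -> 22 < b + m + n ->
       c - 4 < m -> c - 4 < n -> ~ packable [:: n, m & s]) ->
  win s a b c.
Proof.
move=> c4 b6 no2.
pose two s (a b' c' : R) := [/\ b' = b, c' = c & forall m n, 22 < c + m -> 22 < c + n ->
  22 < b + m + n -> c - 4 < m -> c - 4 < n -> ~ packable [:: n, m & s]].
pose one s (a b c' : R) := [/\ c' = c, 22 < a + b & forall n, 22 < c + n ->
  22 < b + n -> c - 4 < n -> ~ packable (n :: s)].
have one_win s' a' b' c' : one s' a' b' c' -> win s' a' b' c'.
  apply: (@win_coind one) => {no2 two}{}s {}a {}b' {}c' x [-> ? no1] px *.
  case: (lerP (a + x) 22) => ax.
    apply: StayA => //; split=> //; first lra.
    move=> n ? ? ? p; apply: (no1 n) => //.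
    by apply: packs_subseq p; rewrite /= !eqxx; exact: subseq_cons.
  case: (lerP 26 (a + c)) => ?; first by apply/Won/win23/win_two_full; lra.
  case: (lerP (c + x) 22) => ?; first by apply: WinC; [|apply/win23/win_two_full; lra].
  (* From [x > c - 4] and [x > 22 - c] follows [x > 9], ample since [a + b' > 22]. *)
  case: (lerP (b' + x) 22) => ?; first by apply: WinB; [|apply: win_two_full; lra].
  by case: (no1 x) => //; lra.
apply: (@win_coind two); last by split.
move=> {no2}{}s {}a _ _ x [-> -> no2] *.
case: (lerP (a + x) 22) => ax.
  apply: StayA => //; split=> // m n ? ? ? ? ? p; apply: (no2 m n) => //.
  by apply: packs_subseq p; rewrite /= !eqxx; exact: subseq_cons.
case: (lerP 26 (a + c)) => ?; first by apply/Won/win23/win_two_full; lra.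
case: (lerP (c + x) 22) => ?; first by apply: WinC; [|apply/win23/win_two_full; lra].
apply: WinB; first lra.
by apply: one_win; split=> //; [lra|move=> n ? ? ?; apply: no2 => //; lra].
Qed.

(** In the critical case [x] on [b] would make the first two loads differ by less than [4 - c], so
    [win_balanced] fails both ways. Then [x] goes to the first bin, and no two of the seen items
    [x], [k], [j], [x0] fit offline beside an item overflowing it. *)
Lemma win_three_mid {s r j k x0 b c} : subseq [:: k; j; x0] s ->
  6 < r + j -> r <= x0 -> r <= b -> 3 <= b < 4 -> j < 4 -> k <= c < 4 ->
  9 + b / 2 < r + j + k -> win s (r + j) b c.
Proof.
move=> kjs rj6 rx0 rb b34 j4 kc rjk.
apply: (@win_coind (fun s a' b' c =>
  [/\ subseq [:: k; j; x0] s, a' = r + j, b' = b & k <= c < 4])) => //.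
move=> {kjs kc}{}s _ _ {}c x [kjs -> -> kc] px _ _ _ sabc *.
have no3 : no_three_over s (r + j) by apply: no_three_over_volume sabc _; lra.
case: (ltrP (c + x) 4) => ?.
  by apply: StayC; [lra|split=> //; [exact: subseq_trans kjs (subseq_cons _ _)|lra]].
case: (lerP (c + x) 6) => ?.
  by apply: WinC; [lra|apply/win23/win12/win_4_6; lra].
case: (lerP (r + j + x) 22) => ?; last first.
  by apply: WinB; [lra|apply/win_no_three_over => //; lra].
case: (lerP (15 + b / 2) (r + j + x + c)) => ?.
  by apply: WinA; [lra|apply/win23/win_two_15; lra].
case: (lerP (b + x + 4) (r + j + c)) => ?.
  by apply: WinB; [lra|apply: win_balanced; lra].
case: (lerP (r + j + 4) (b + x + c)) => ?.
  by apply: WinB; [lra|apply/win12/win_balanced; lra].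
apply: WinA => //; apply: win_two_small; try lra.
apply: (@no_three_over_subseq [:: x; k; j; x0]); first by rewrite /= eqxx.
by move=> m n p ? ? ?; apply: (@four_pairs_3big _ _ _ _ _ _ _ (22 - (r + j + x))); lra.
Qed.

Lemma win_two_mid {s r j x0 b} : subseq [:: j; x0] s ->
  6 < r + j -> r <= x0 -> r <= b -> 3 <= b < 4 -> j < 4 -> win s (r + j) b 0.
Proof.
move=> js rj6 rx0 rb b34 j4.
apply: (@win_coind (fun s a' b c =>
  [/\ subseq [:: j; x0] s, a' = r + j, r <= b, 3 <= b < 4 & c = 0])) => //.
move=> {js rb b34}{}s _ {}b _ k [js -> rb b34 ->] px _ _ _ sabc *.
have no3 : no_three_over s (r + j) by apply: no_three_over_volume sabc _; lra.
case: (lerP (r + j + k) 22) => ?; last first.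
  by apply: WinB; [lra|apply/win_no_three_over => //; lra].
case: (lerP 15 (r + j + k + b)) => ?.
  by apply: WinA; [lra|apply: win_two_15; lra].
case: (ltrP (b + k) 4) => ?.
  by apply: StayB; [lra|split=> //; [exact: subseq_trans js (subseq_cons _ _)|lra..]].
case: (lerP (b + k) 6) => ?; first by apply: WinB; [lra|apply/win12/win_4_6; lra].
case: (lerP 4 k) => ?; first by apply: WinC; [lra|apply/win23/win12/win_4_6; lra].
(* Up to [9 + b / 2], volume alone excludes three items overflowing the first bin. *)
case: (lerP (r + j + k) (9 + b / 2)) => ?.
  by apply: WinA; [lra|apply: win_12_3_4; lra].
apply: WinC; first lra.
by apply: (@win_three_mid _ _ _ k x0); try lra; rewrite /= eqxx.
Qed.

(** A medium [j] goes to the lighter bin, since the heavier one is above 3. The load under [j] is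
    then at most the item [b], which serves as [x0]. *)
Lemma win_mid_item {s a b} : b \in s -> a < 4 -> b < 4 -> 6 < a + b -> win s a b 0.
Proof.
move=> sb a4 b4 ab6.
apply: (@win_coind (fun s a b' c =>
  [/\ b \in s, a < 4, 6 < a + b, b' = b & c = 0])) => //.
move=> {sb a4 ab6}{}s {}a _ _ j [sb a4 ab6 -> ->] *.
case: (ltrP (a + j) 4) => ?.
  by apply: StayA; [lra|split=> //; [rewrite inE sb orbT|lra]].
case: (lerP (a + j) 6) => ?; first by apply: WinA; [lra|apply/win_4_6; lra].
case: (lerP (b + j) 6) => ?; first by apply: WinB; [lra|apply/win12/win_4_6; lra].
have jbs : subseq [:: j; b] (j :: s) by rewrite /= eqxx sub1seq.
have jjs : j \in j :: s by rewrite inE eqxx.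
case: (lerP j 6) => ?; last first.
  case: (lerP 3 b) => ?; first by apply: WinA; [|apply: (win_big_3_6 jjs)]; lra.
  by apply: WinB; [|apply/win12/(win_big_3_6 jjs)]; lra.
case: (lerP 4 j) => ?; first by apply: WinC; [lra|apply/win23/win12/win_4_6; lra].
case: (lerP a b) => ?; first by apply: WinA; [|apply: (win_two_mid jbs)]; lra.
by apply: WinB; [|apply/win12/(win_two_mid jbs)]; lra.
Qed.

(** By [a < a0 + 6], an item overflowing [a] exceeds [16 - a0], so it cannot join [a0] offline. By
    [12 <= a + b], an item above 3 that fits into [a] lifts the pair to 15. *)
Lemma win_big_mid {s a b a0} : a0 \in s -> 6 < a0 -> a0 <= a -> a < a0 + 6 ->
  12 <= a + b -> 2 <= b < 3 -> win s a b 0.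
Proof.
move=> sa0 a06 a0a aa0 ab b3.
apply: (@win_coind (fun s a' b c =>
  [/\ a0 \in s, a' = a, 12 <= a + b, 2 <= b < 3 & c = 0])) => //.
move=> {sa0 ab b3}{}s _ {}b _ x [sa0 -> ab b3 ->] *.
have sa0' : a0 \in x :: s by rewrite inE sa0 orbT.
case: (lerP 15 (a + b)) => ?; first by apply: Won; apply: win_two_15; lra.
case: (ltrP (b + x) 3) => ?; first by apply: StayB; [lra|split=> //; lra].
case: (lerP (b + x) 6) => ?; first by apply: WinB; [|apply: (win_big_3_6 sa0')]; lra.
case: (lerP (a + x) 22) => ?; first by apply: WinA; [|apply: win_two_15]; lra.
apply: WinB; first lra.
apply: win_no_three_over => //; try lra.
apply: (@no_three_over_subseq [:: a0]); first by rewrite sub1seq.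
by move=> m n p ? ? ?; apply: four_big; lra.
Qed.

Lemma win_two_big {s a b a0 j} : subseq [:: j; a0] s -> 6 < a0 -> 6 < j ->
  a0 + j <= a -> b < 3 -> win s a b 0.
Proof.
move=> js a06 j6 a0ja b3.
apply: (@win_coind (fun s a' b c =>
  [/\ subseq [:: j; a0] s, a' = a, b < 3 & c = 0])) => //.
move=> {js b3}{}s _ {}b _ y [js -> b3 ->] *.
have sa0 : a0 \in y :: s.
  by rewrite inE (mem_subseq js) ?orbT // !inE eqxx orbT.
case: (lerP 15 (a + b)) => ?; first by apply: Won; apply: win_two_15; lra.
case: (ltrP (b + y) 3) => ?.
  by apply: StayB; [lra|split=> //; exact: subseq_trans js (subseq_cons _ _)].
case: (lerP (b + y) 6) => ?; first by apply: WinB; [|apply: (win_big_3_6 sa0)]; lra.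
case: (lerP (a + y) 22) => ?; first by apply: WinA; [|apply: win_two_15]; lra.
case: (lerP 26 (a + b + y)) => ?; first by apply: WinB; [|apply: win_two_full]; lra.
(* Two items violating the premise of [win_two_over] would occupy, with [y], distinct offline bins
   without room for both [a0] and [j]. *)
apply: WinC; first lra.
apply: win_two_over; try lra.
move=> m n ? ? ? ? ?; have {}js : subseq [:: n; m; y; j; a0] [:: n, m, y & s].
  by rewrite /= !eqxx.
move=> /(packs_subseq js)/packable_3big H.
have {H}: packs [:: j; a0] (16 - n) (16 - m) (16 - y) by apply: H; lra.
by case=> _ [] [_ []] [? ? ?]; lra.
Qed.

Lemma win_big_item {s a b} : a \in s -> 6 < a -> b < 3 -> win s a b 0.
Proof.
move=> sa a6 b3.
apply: (@win_coind (fun s a' b c => [/\ a \in s, a' = a, b < 3 & c = 0])) => //.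
move=> {sa b3}{}s _ {}b _ x [sa -> b3 ->] *.
have sa' : a \in x :: s by rewrite inE sa orbT.
case: (lerP 15 (a + b)) => ?; first by apply: Won; apply: win_two_15; lra.
case: (ltrP (b + x) 3) => ?; first by apply: StayB; [lra|split].
case: (lerP (b + x) 6) => ?; first by apply: WinB; [|apply: (win_big_3_6 sa')]; lra.
case: (lerP (a + x) 22) => ?; last first.
  apply: WinC; first lra.
  (* The bin of [x] is filled next, and [a] plays the role of [c]. Bad items [m], [n] would make
     four pairwise incompatible items with [a] and [x]: for instance
     [x + m > (22 - a) + (a - 4)]. *)
  apply/win12/win23/win12; apply: win_two_over; try lra.
  move=> m n ? ? ? ? ?.
  have {}sa : subseq [:: n; m; x; a] [:: n, m, x & s].
    by rewrite /= !eqxx sub1seq.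
  by move=> /(packs_subseq sa); apply: four_big; lra.
case: (lerP 15 (a + x + b)) => ?; first by apply: WinA; [|apply: win_two_15]; lra.
case: (lerP x 6) => ?; last first.
  apply: WinA => //; apply: (@win_two_big _ _ _ a x); try lra.
  by rewrite /= eqxx sub1seq.
case: (lerP 4 x) => ?; first by apply: WinC; [lra|apply/win23/win12/win_4_6; lra].
by apply: WinA => //; apply: (@win_big_mid _ _ _ a) => //; lra.
Qed.

(** The first bin collects items until it lands between 4 and 6 or an item would jump past 6; that
    item opens the second bin, and its size selects the case. *)
Lemma win_start : win [::] 0 0 0.
Proof.
apply: (@win_coind (fun (_ : seq R) a b c => [/\ a < 4, b = 0 & c = 0])); last by split; lra.
move=> s a _ _ x [a4 -> ->] *.
have xs : x \in x :: s by rewrite inE eqxx.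
case: (ltrP (a + x) 4) => ?; first by apply: StayA; [lra|split].
case: (lerP (a + x) 6) => ?; first by apply: WinA; [lra|apply/win_4_6; lra].
apply: WinB; rewrite ?add0r; first lra.
case: (ltrP x 4) => ?; first by apply: win_mid_item => //; lra.
case: (lerP x 6) => ?; first by apply/win12/win_4_6; lra.
case: (lerP 3 a) => ?; first by apply/win12/(win_big_3_6 xs); lra.
by apply/win12/win_big_item.
Qed.

End Packable.

(** * The algorithm extracted from the winning configurations *)

Section Algorithm.

Context {R : realType}.
Implicit Types (s t : seq R) (L : 'I_3 -> R) (x : R).

Local Notation packable s := (packs s 16 16 16).

Definition put L i x : 'I_3 -> R := fun j => L j + (if i == j then x else 0).

Definition winning s L := win s (L 0) (L 1) (L 2).

Definition good_bin s L x i := `[< L i + x <= 22 /\ winning (x :: s) (put L i x) >].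

(** Winning is tested classically. The default bin 0 is never reached on packable inputs, by
    [loads_safe]. *)
Definition choose_bin s L x : 'I_3 := odflt 0 [pick i | good_bin s L x i].

Fixpoint loads s : 'I_3 -> R :=
  if s is x :: s' then put (loads s') (choose_bin s' (loads s') x) x
  else fun=> 0.

Definition bin3 : online_algorithm R 3 := fun past x =>
  let s := rev [seq 16 * y | y <- past] in choose_bin s (loads s) (16 * x).

Lemma put_ge0 L i x : (forall j, 0 <= L j) -> 0 <= x -> forall j, 0 <= put L i x j.
Proof. by move=> L0 x0 j; rewrite addr_ge0 //; case: ifP. Qed.

(** Every prefix of a packable input is packable, so [win_stable] supplies a good bin at each
    arrival. *)
Lemma loads_safe {s} : packable s -> [/\ winning s (loads s),
  forall j, 0 <= loads s j <= 22 &
  \sum_(y <- s) y = loads s 0 + loads s 1 + loads s 2].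
Proof.
elim: s => [_|x s IHs xs].
  by split=> [|j|] /=; [exact: win_start|lra|rewrite big_nil; lra].
have [|winL L22 sL] := IHs; first exact: packs_subseq (subseq_cons s x) xs.
have x0 := packable_item xs.
have L0 j : 0 <= loads s j by case/andP: (L22 j).
have good i : loads s i + x <= 22 -> winning (x :: s) (put (loads s) i x) ->
    [exists i, good_bin s (loads s) x i].
  by move=> ix wx; apply/existsP; exists i; apply/asboolP.
have vs : valid s (loads s 0) (loads s 1) (loads s 2) by split.
have {good}: [exists i, good_bin s (loads s) x i].
  case: (win_stable _ _ _ _ _ winL vs xs) => -[Lx wx];
    [apply: (good 0)|apply: (good 1)|apply: (good 2)] => //;
    by rewrite /winning /put /= !addr0.
rewrite /= /choose_bin; case: pickP => [i /asboolP[ix wx] _|none /existsP[i]].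
  2: by rewrite none.
split=> //= [j|].
  rewrite put_ge0 //=; last by case/andP: x0.
  by rewrite /put; case: eqP => [<-//|_]; have /andP[] := L22 j; rewrite addr0.
rewrite big_cons sL /put.
by case: i {ix wx} => -[|[|[|//]]] ?; rewrite /eq_op /= ; lra.
Qed.

(** * From indexed packings to scaled, reversed histories *)

(** A bin choice on all of [nat] does not depend on [size s], which permits induction on the last
    item. *)
Lemma bin_load_nat m s (p : packing m s) (f : nat -> 'I_m) b :
  (forall i : 'I_(size s), p i = f i) ->
  bin_load p b = \sum_(0 <= i < size s | f i == b) s`_i.
Proof. by move=> pf; rewrite big_mkord; apply: eq_bigl => i; rewrite pf. Qed.

Lemma bin_load_rcons m s x (f : nat -> 'I_m) b :
  \sum_(0 <= i < size (rcons s x) | f i == b) (rcons s x)`_i =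
  \sum_(0 <= i < size s | f i == b) s`_i + (if f (size s) == b then x else 0).
Proof.
rewrite size_rcons big_mkcond big_nat_recr //= nth_rcons ltnn eqxx -big_mkcond /=.
congr (_ + _); rewrite big_nat_cond [RHS]big_nat_cond.
by apply: eq_bigr => i /andP[/andP[_ i_s] _]; rewrite nth_rcons i_s.
Qed.

Lemma bin3_load s b :
  16 * bin_load (online_packing bin3 s) b = loads (rev [seq 16 * y | y <- s]) b.
Proof.
rewrite (@bin_load_nat _ _ _ (fun i => bin3 (take i s) s`_i)) //.
elim/last_ind: s => [|s x IHs]; first by rewrite big_nil mulr0.
rewrite bin_load_rcons map_rcons rev_rcons /= /put -IHs mulrDr; congr (16 * _ + _).
  rewrite big_nat_cond [RHS]big_nat_cond; apply: eq_bigl => i.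
  case: ltnP => //= i_s; rewrite nth_rcons i_s -cats1 takel_cat //.
  exact: ltnW.
rewrite nth_rcons ltnn eqxx -cats1 take_size_cat // /bin3.
by case: eqP => // _; rewrite mulr0.
Qed.

Lemma packs_rev s (f : nat -> 'I_3) u v w : {in s, forall x, 0 <= x} ->
  16 * \sum_(0 <= i < size s | f i == 0) s`_i <= u ->
  16 * \sum_(0 <= i < size s | f i == 1) s`_i <= v ->
  16 * \sum_(0 <= i < size s | f i == 2) s`_i <= w ->
  packs (rev [seq 16 * y | y <- s]) u v w.
Proof.
elim/last_ind: s u v w => [|s x IHs] u v w s0.
  by rewrite /= !big_nil => ? ? ?; split; lra.
have x0 : 0 <= x by apply: s0; rewrite mem_rcons inE eqxx.
have {}s0 : {in s, forall x, 0 <= x}.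
  by move=> y ys; apply: s0; rewrite mem_rcons inE ys orbT.
rewrite !bin_load_rcons map_rcons rev_rcons /=.
have: [|| f (size s) == 0, f (size s) == 1 | f (size s) == 2].
  by case: (f _) => -[|[|[]]].
case/or3P => /eqP-> /= ? ? ?; (split; first lra);
  [apply: Or31|apply: Or32|apply: Or33]; apply: IHs => //; lra.
Qed.

Lemma packing_packable {s} (p : packing 3 s) : {in s, forall x, 0 <= x} ->
  fits p 1 -> packable (rev [seq 16 * y | y <- s]).
Proof.
(* [f] extends [p] by bin 0 beyond the input, where no item is counted. *)
move=> s0 p1; pose f i := odflt 0 (omap p (insub i)).
have pf i : p i = f i by rewrite /f valK.
have fit b : 16 * \sum_(0 <= i < size s | f i == b) s`_i <= 16.
  by have := p1 b; rewrite (bin_load_nat _ _ _ _ _ pf); lra.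
exact: packs_rev s0 (fit _) (fit _) (fit _).
Qed.

End Algorithm.

Theorem theorem1 (R : realType) :
  exists alg : online_algorithm R 3, has_stretching_factor alg (11 / 8).
Proof.
exists bin3; split; first lra.
move=> s s01 [p p1] b.
have s0 : {in s, forall x, 0 <= x} by move=> x /s01/andP[].
have [_ L22 _] := loads_safe (packing_packable p s0 p1).
by have := L22 b; rewrite -bin3_load; lra.
Qed.
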